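(* Let $\theta>0$ and $\mu\in\mathcal P([0,\infty])$. Then for any $n\ge1$, $$\theta R_n^*(\theta,\mu)\ \overset{d}{=}\ \log Y_n^\mu(\theta)-\log E,$$ where $Y_n^\mu(\theta):=\sum_{|v|=n}e^{\theta S(v)}Y_v$, $\{Y_v\}_{|v|=n}$ are i.i.d. with law $\mu$, independent of the branching random walk, and $E\sim$ Exponential(1) is independent of $Y_n^\mu(\theta)$. In other words, for all $x\in\mathbb R$, $$\mathbb P\left(R_n^*(\theta,\mu)\le x\right)=\mathbb E\left[\exp\left(-e^{-\theta x}\sum_{|v|=n}e^{\theta S(v)}Y_v\right)\right].$$
   Context: $\mathcal P([0,\infty])$ is the set of probability measures on $[0,\infty]$. Branching random walk (BRW). Let $Z=\sum_{j=1}^N\delta_{\xi_j}$ be a point process on $\mathbb R$ with $N:=Z(\mathbb R)<\infty$ a.s. Start with one particle at $0$ in generation $0$. Each particle of generation $n-1$ independently produces offspring (generation $n$) whose displacements from the parent's position are the atoms of an independent copy of $Z$. For a particle $v$, $|v|$ is its generation and $S(v)$ its position. Standing assumptions of the paper: with $m(\theta):=\mathbb E\left[\sum_{j=1}^Ne^{\theta\xi_j}\right]$, (A1) there is $\vartheta>0$ with $m(\theta)<\infty$ for all $\theta\in(-\vartheta,\infty)$; (A2) $\mathbb P(N=1)<1$, $\mathbb P(Z(\{t\})=N)<1$ for every $t\in\mathbb R$, and $\mathbb P(N\ge1)=1$; (A3) $\mathbb E[N^{1+p}]<\infty$ for some $p>0$. Last progeny modified BRW. For each $n\ge1$ let $\{Y_v\}_{|v|=n}$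 be i.i.d. with law $\mu$ and $\{E_v\}_{|v|=n}$ i.i.d. Exponential(1), independent of each other and of $(S(u))_{|u|\le n}$. With $\log0=-\infty$, $\log\infty=\infty$ (and $e^{-\infty}=0$), $$R_n^*(\theta,\mu):=\max_{|v|=n}\left\{S(v)+\tfrac1\theta\left(\log Y_v-\log E_v\right)\right\}.$$ *)

(* Defs.v *)
From mathcomp Require Import all_boot all_order all_algebra finmap.
From mathcomp Require Import all_classical all_reals all_analysis.
(* not re-exported by all_analysis; carries the Borel sigma-algebra of \bar R *)
From mathcomp Require Import measurable_realfun.

Set Implicit Arguments.
Unset Strict Implicit.
Unset Printing Implicit Defensive.

Import Order.TTheory GRing.Theory Num.Theory.
Import numFieldNormedType.Exports.

Local Open Scope classical_set_scope.
Local Open Scope ring_scope.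

Definition independent d (T : measurableType d) (R : realType)
    (P : probability T R) (I : choiceType) (D : set I)
    (F : I -> set (set T)) : Prop :=
  forall (J : {fset I}) (A : I -> set T),
    [set` J] `<=` D -> (forall i, i \in J -> F i (A i)) ->
    P (\bigcap_(i in [set` J]) A i) = (\prod_(i <- J) P (A i))%E.

Definition sigma_family d d' (T : measurableType d) (T' : measurableType d')
    (I : Type) (D : set I) (X : I -> T -> T') : set (set T) :=
  <<s \bigcup_(i in D) g_sigma_algebra_preimage (X i) >>.

(* A point process on R with finitely many atoms, given with an enumeration:
   the atoms are [pp_atom j] for j < [pp_size]. The values of [pp_atom j] for
   j >= [pp_size] are meaningless and no definition below depends on them. *)
Record point_process d (T : measurableType d) (R : realType) := PointProcess {
  pp_size : {mfun T >-> nat};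
  pp_atom : nat -> {mfun T >-> R} }.

Section point_process.
Context d (T : measurableType d) (R : realType).
Implicit Types Z : point_process T R.

Definition pp_count Z (w : T) (B : set R) : nat :=
  (\sum_(j < pp_size Z w) (pp_atom Z j w \in B))%N.

Definition pp_sigma Z : set (set T) :=
  <<s [set A | exists (j : nat) (B : set R), measurable B /\
        A = [set w | (j < pp_size Z w)%N /\ B (pp_atom Z j w)] ] >>.

Definition pp_mgf (P : probability T R) Z (theta : R) : \bar R :=
  'E_P[fun w => \sum_(j < pp_size Z w) expR (theta * pp_atom Z j w)].

End point_process.

(* The sigma-algebra on counting measures generated by the evaluations at
   Borel sets. *)
Definition counting_sigma (R : realType) : set (set (set R -> nat)) :=
  <<s [set C | exists (B : set R) (k : nat), measurable B /\
        C = [set z | z B = k] ] >>.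

(* Equality in law as point processes: the enumerations play no role. *)
Definition pp_same_law d (T : measurableType d) d' (T' : measurableType d')
    (R : realType) (P : probability T R) (Z : point_process T R)
    (P' : probability T' R) (Z' : point_process T' R) : Prop :=
  forall C, counting_sigma C ->
    P (pp_count Z @^-1` C) = P' (pp_count Z' @^-1` C).

Section standing_assumptions.
Context d (T : measurableType d) (R : realType).
Variables (P : probability T R) (Z : point_process T R).

Definition assumptionA1 : Prop :=
  exists2 vartheta : R, 0 < vartheta &
    forall theta : R, - vartheta < theta -> (pp_mgf P Z theta < +oo)%E.

Definition assumptionA2 : Prop :=
  [/\ (P [set w | pp_size Z w = 1%N] < 1)%E,
      (forall t : R, P [set w | pp_count Z w [set t] = pp_size Z w] < 1)%E &
      P [set w | (1 <= pp_size Z w)%N] = 1%E].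

Definition assumptionA3 : Prop :=
  exists2 p : R, 0 < p & ('E_P[fun w => powR (pp_size Z w)%:R (1 + p)] < +oo)%E.

End standing_assumptions.

(* Particles carry Ulam-Harris labels in [seq nat]: [::] is the initial
   particle and [rcons v j] is the j-th child of v. [X v] is the displacement
   point process attached to the label v, whether or not v is alive. *)
Section branching_random_walk.
Context d (T : measurableType d) (R : realType).
Variable X : seq nat -> point_process T R.

Definition is_brw (P : probability T R) d0 (T0 : measurableType d0)
    (P0 : probability T0 R) (Z : point_process T0 R) : Prop :=
  (forall v, pp_same_law P (X v) P0 Z) /\
  independent P [set: seq nat] (fun v => pp_sigma (X v)).

Fixpoint generation (n : nat) (w : T) : seq (seq nat) :=
  if n is n'.+1 then
    [seq rcons v j | v <- generation n' w, j <- iota 0 (pp_size (X v) w)]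
  else [:: [::]].

Definition position (v : seq nat) (w : T) : R :=
  \sum_(i < size v) pp_atom (X (take i v)) (nth 0%N v i) w.

(* sigma-algebra of (S(u))_{|u| <= n}: which particles are alive, and where *)
Definition brw_sigma (n : nat) : set (set T) :=
  <<s [set A | exists (v : seq nat) (B : set R),
        [/\ (size v <= n)%N, measurable B &
         A = [set w | v \in generation (size v) w /\ B (position v w)] ] ] >>.

Section last_progeny.
Variables (theta : R) (n : nat).
Variable Y : seq nat -> {mfun T >-> \bar R}.
Variable E : seq nat -> {mfun T >-> R}.

(* [Y v] and [E v] matter only for the labels v of length n. *)
Record is_lpm_marks (P : probability T R) (mu : probability (\bar R) R)
    : Prop := {
  lpm_Y_law : forall v, size v = n -> forall B, measurable B ->
    distribution P (Y v) B = mu B ;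
  lpm_Y_indep : independent P [set v | size v = n]
    (fun v => g_sigma_algebra_preimage (Y v)) ;
  lpm_E_law : forall v, size v = n -> forall B, measurable B ->
    distribution P (E v) B = exponential_prob 1 B ;
  lpm_E_indep : independent P [set v | size v = n]
    (fun v => g_sigma_algebra_preimage (E v)) ;
  lpm_indep : independent P [set: 'I_3]
    (tnth [tuple brw_sigma n;
                 sigma_family [set v | size v = n] (fun v => Y v : T -> \bar R);
                 sigma_family [set v | size v = n] (fun v => E v : T -> R)]) }.

Definition lpm_max (w : T) : \bar R :=
  (\big[maxe/-oo]_(v <- generation n w)
     ((position v w)%:E + theta^-1%:E * (lne (Y v w) - lne (E v w)%:E)))%E.

Definition lpm_sum (w : T) : \bar R :=
  (\sum_(v <- generation n w) (expR (theta * position v w))%:E * Y v w)%E.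

End last_progeny.
End branching_random_walk.

(* Main.v *)
(** Conditionally on the branching random walk and the [Y v], the event
    [lpm_max <= x] says that [c * exp (theta * S v) * Y v <= E v] for every
    particle [v] of generation [n], with [c = exp (- theta * x)], and has
    probability [exp (- c * lpm_sum)] by independence of the [E v]. A single
    exponential variable compared with [c * lpm_sum] gives the same
    probability, so both sides of the identity in law have the same
    distribution function.

    Conditioning is replaced by Tonelli's theorem, applied to one [E v] at a
    time. As the set of particles is random, dead labels get the threshold [0],
    the thresholds are imposed on the first [k] labels in an enumeration of all
    labels of length [n], and [k] tends to infinity. *)
Require Import Defs.
From mathcomp Require Import all_boot all_order all_algebra finmap.
From mathcomp Require Import all_classical all_reals all_analysis.
From mathcomp Require Import measurable_realfun.

Import Order.TTheory GRing.Theory Num.Theory.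
Import numFieldNormedType.Exports.

Local Open Scope classical_set_scope.
Local Open Scope ring_scope.

(** * Exponential and logarithm on the extended reals *)

Section ereal_exp_ln.
Context {R : realType}.
Implicit Types (x y : \bar R) (r : R).
Local Open Scope ereal_scope.

(** [lne] sends every [y <= 0] to [-oo], so this Galois connection holds for negative [y] too. It
    turns preimages of rays into rays, which gives the measurability of [lne]; [le_expeR] does the
    same for [expeR]. *)
Lemma lne_le_EFin y r : (lne y <= r%:E) = (y <= (expR r)%:E).
Proof.
case: y => [s| |] //=; last by rewrite !leNye.
case: ifPn => [s0|]; first by rewrite leNye lee_fin (le_trans s0)// expR_ge0.
by rewrite -ltNge => s0; rewrite !lee_fin -ler_expR lnK.
Qed.

Lemma le_expeR x y : (x <= expeR y) = (lne x <= y).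
Proof.
case: x => [r| |]/=; last by rewrite !leNye.
  case: ifPn => [r0|].
    by rewrite leNye; apply: (@le_trans _ _ 0%E); rewrite ?lee_fin ?expeR_ge0.
  rewrite -ltNge => r0; rewrite -[in LHS](lnK r0).
  by rewrite -[X in X <= _]/(expeR (ln r)%:E) lee_expeR.
by rewrite !leye_eq expeR_eqy.
Qed.

Lemma measurable_expeR : measurable_fun [set: \bar R] (@expeR R).
Proof.
move=> mD; apply: (measurability _ (ErealGenCInfty.measurableE R)) => //.
move=> _ [_ [r ->] <-]; rewrite setTI.
rewrite [X in measurable X](_ : _ = `[lne r%:E, +oo[%classic).
  exact: emeasurable_itv.
by apply/seteqP; split => y /=; rewrite !in_itv/= !andbT le_expeR.
Qed.

Lemma measurable_lne : measurable_fun [set: \bar R] (@lne R).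
Proof.
move=> mD; apply: (measurability _ (ErealGenOInfty.measurableE R)) => //.
move=> _ [_ [r ->] <-]; rewrite setTI.
rewrite [X in measurable X](_ : _ = `](expR r)%:E, +oo[%classic).
  exact: emeasurable_itv.
by apply/seteqP; split => y /=; rewrite !in_itv/= !andbT !ltNge lne_le_EFin.
Qed.

End ereal_exp_ln.

(** * The standard exponential law *)

Section exponential_law.
Context {R : realType}.
Local Open Scope ereal_scope.

Lemma exponential_prob1_itvcy (r : R) : (0 <= r)%R ->
  exponential_prob 1 `[r, +oo[ = (expR (- r))%:E.
Proof.
move=> r0; rewrite /exponential_prob.
have cexp : continuous (fun z : R^o => expR (- 1 * z) : R^o).
  move=> z; apply: continuous_comp; last exact: continuous_expR.
  by apply: continuousM => //; apply: (@continuousN _ R^o); exact: cst_continuous.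
(* A primitive of the density is [- expR (- x)]; the final [0%R] is its limit at [+oo]. *)
rewrite (@ge0_continuous_FTC2y _ _ (fun x => - (expR (- 1 * x)))%R _ 0%R)//.
- by rewrite mulN1r sub0e EFinN oppeK.
- by move=> x _; apply: exponential_pdf_ge0.
- apply: (@continuous_subspaceW R^o _ _ [set` `[0%R, +oo[]).
    by apply: subset_itvr; rewrite bnd_simp.
  exact: within_continuous_exponential_pdf.
- rewrite -oppr0; apply: cvgN.
  rewrite (_ : (fun x => expR (- 1 * x)) = fun z => expR (- z)); last first.
    by apply/funext => x; rewrite mulN1r.
  exact: cvgr_expR.
- by apply: cvgN; apply/cvg_at_right_filter; exact: cexp.
- move=> z; rewrite in_itv/= andbT => rz.
  by apply: derive1_exponential_pdf; rewrite in_itv/= andbT (le_lt_trans r0).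
Qed.

Context {d} {T : measurableType d} {P : probability T R}.
Variable E : {mfun T >-> R}.
Hypothesis E_law : forall B, measurable B ->
  distribution P E B = exponential_prob 1 B.

(** An infinite [t] is allowed because the marks [Y v] may be infinite: the event is then empty and
    [expeR -oo] is [0]. *)
Lemma exponential_tail (t : \bar R) : 0 <= t ->
  distribution P E [set e | t <= e%:E] = expeR (- t).
Proof.
case: t => [r||] //= r0; last first.
  by rewrite (_ : [set _ | _] = set0) ?measure0// -subset0 => e /=.
rewrite -exponential_prob1_itvcy// -E_law; last exact: measurable_itv.
by congr (distribution P E _); apply/seteqP; split=> x /=;
  rewrite in_itv/= andbT lee_fin.
Qed.

(** The tail at [0] is [1], and removing the endpoint [0] does not change the integral of the
    density. The logarithm of [E] is thus finite off a null set. *)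
Lemma exponential_le0_negligible : P.-negligible [set w | (E w <= 0)%R].
Proof.
have -> : [set w | (E w <= 0)%R] = E @^-1` (~` `]0%R, +oo[).
  by apply/seteqP; split => w /=; rewrite in_itv/= andbT leNgt => /negP.
have mpos : measurable (~` `]0%R, +oo[ : set R) by exact: measurableC.
apply/negligibleP; first exact: (measurable_funPTI E mpos).
have E1 : distribution P E `]0%R, +oo[ = 1.
  rewrite E_law// /exponential_prob integral_itv_obnd_cbnd.
    rewrite -/(exponential_prob 1 `[0%R, +oo[) exponential_prob1_itvcy//.
    by rewrite oppr0 expR0.
  apply/measurable_funTS/measurable_EFinP.
  exact: measurable_exponential_pdf.
transitivity (distribution P E (~` `]0%R, +oo[)) => //.
by rewrite probability_setC//; move: E1 => /= ->; rewrite subee.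
Qed.

End exponential_law.

(** * Integrating out one exponential variable *)

Section exponential_threshold.
Context {R : realType} {d d'} {T : measurableType d} {T' : measurableType d'}.
Context {P : probability T R}.
Local Open Scope ereal_scope.
Variables (h : {mfun T >-> T'}) (E : {mfun T >-> R}).
Hypothesis E_law : forall B, measurable B ->
  distribution P E B = exponential_prob 1 B.
Hypothesis hE_indep : forall A B, measurable A -> measurable B ->
  P (h @^-1` A `&` E @^-1` B) = P (h @^-1` A) * P (E @^-1` B).

(** By independence the law of the pair agrees with the product of the laws on rectangles, hence
    everywhere; Tonelli's theorem then applies. *)
Lemma ge0_integral_pair (F : T' * R -> \bar R) : measurable_fun [set: T' * R] F ->
  (forall z, 0 <= F z) ->
  \int[P]_w F (h w, E w) =
  \int[distribution P h]_a \int[distribution P E]_e F (a, e).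
Proof.
move=> mF F0.
have mhE : measurable_fun [set: T] (fun w => (h w, E w)) by exact: measurable_fun_pair.
rewrite -(@fubini_tonelli1 _ _ _ _ _ (distribution P h) (distribution P E) F)//.
rewrite (@eq_measure_integral _ _ _ _ (distribution P (mfun_Sub (mem_set mhE)))).
  by rewrite ge0_integral_distribution.
move=> A mA _; apply: product_measure_unique => // B C mB mC.
Qed.

Variables (f W : T' -> \bar R).
Hypothesis mf : measurable_fun [set: T'] f.
Hypothesis mW : measurable_fun [set: T'] W.
Hypothesis f0 : forall a, 0 <= f a.
Hypothesis W0 : forall a, 0 <= W a.

(** With the value [a] of [h] frozen, the inner integral over [E] is [f a] times the exponential
    tail at [W a]. The factor [f] leaves room for the other thresholds when the lemma is
    iterated. *)
Lemma ge0_integral_exponential_threshold :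
  \int[P]_w (f (h w) * (\1_[set w | (W (h w) <= (E w)%:E)%E] w)%:E) =
  \int[P]_w (f (h w) * expeR (- W (h w))).
Proof.
pose D := [set z : T' * R | W z.1 <= z.2%:E].
have mD : measurable D.
  rewrite -[D]setTI; apply: measurable_lee => //.
    exact: measurableT_comp.
  exact/measurable_EFinP.
have := @ge0_integral_pair (fun z => f z.1 * (\1_D z)%:E).
move=> ->; last 2 first.
- apply: emeasurable_funM; first exact: measurableT_comp.
  exact/measurable_EFinP/measurable_indic.
- by move=> z; rewrite mule_ge0// lee_fin.
transitivity (\int[distribution P h]_a (f a * expeR (- W a))); last first.
  rewrite ge0_integral_distribution//.
    apply: emeasurable_funM => //.
    by apply: measurableT_comp; [exact: measurable_expeR|exact: measurableT_comp].
  by move=> a; rewrite mule_ge0// expeR_ge0.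
apply: eq_integral => a _ /=.
pose Da := [set e : R | W a <= e%:E].
have mDa : measurable Da.
  rewrite -[Da]setTI; apply: measurable_lee => //; exact/measurable_EFinP.
transitivity (\int[distribution P E]_e (f a * (\1_Da e)%:E)).
  exact: eq_integral.
rewrite ge0_integralZl//; last exact/measurable_EFinP/measurable_indic.
by rewrite integral_indic// setIT; congr (_ * _); exact: exponential_tail.
Qed.
End exponential_threshold.

(** * Independence and generated sigma-algebras *)

Section independence.
Context {R : realType} {d} {T : measurableType d} {P : probability T R}.
Implicit Types (G H : set (set T)) (C : set T).
Local Open Scope ereal_scope.

(** Dynkin's argument: the measurable [A] satisfying the product formula with [C] form a Dynkin
    system, and [G] is a pi-system. *)
Lemma indep_g_sigma_algebra G C : G `<=` measurable -> setI_closed G -> measurable C ->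
  (forall A, G A -> P (A `&` C) = P A * P C) ->
  forall A, <<s G >> A -> P (A `&` C) = P A * P C.
Proof.
move=> mG GI mC GC.
have sGm : <<s G >> `<=` measurable.
  by apply: smallest_sub => //; exact: sigma_algebra_measurable.
have PCfin : P C \is a fin_num by rewrite fin_num_measure.
have PE A : measurable A -> P (~` A `&` C) = P C - P (A `&` C).
  move=> mA; rewrite setIC -setDE measureD//; first by rewrite [C `&` A]setIC.
  by rewrite ltey_eq PCfin.
rewrite -setI_closed_g_dynkin_g_sigma_algebra//.
pose S := [set A | measurable A /\ P (A `&` C) = P A * P C].
suff : <<d G >> `<=` S by move=> sS A /sS[].
apply: smallest_sub; last by move=> A GA; split; [exact: mG|exact: GC].
split.
- by split => //; rewrite setTI probability_setT mul1e.
- move=> A [mA PA]; split; first exact: measurableC.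
  rewrite PE// PA probability_setC// muleBl ?mul1e//.
- move=> F tF SF; have mF k : measurable (F k) by case: (SF k).
  split; first exact: bigcup_measurable.
  rewrite setI_bigcupl !measure_bigcup//; last 2 first.
  + by move=> k _; exact: measurableI.
  + exact: trivIset_setIr.
  rewrite muleC -(fineK PCfin) -nneseriesZl//.
  by apply: eq_eseriesr => k _; rewrite fineK// muleC; case: (SF k).
Qed.

Lemma sigma_algebra_setI G : sigma_algebra [set: T] G -> setI_closed G.
Proof.
move=> sG A B GA GB; rewrite -(sigma_algebra_id sG).
by apply: (@measurableI _ (g_sigma_algebraType G)); rewrite /measurable/= sigma_algebra_id.
Qed.

(** The intersections of a set of [G] with a set of [H] form a pi-system. It contains both [G] and
    [H], since each of them contains the whole space. *)
Lemma indep_sigma_join G H C : sigma_algebra [set: T] G -> sigma_algebra [set: T] H ->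
  G `<=` measurable -> H `<=` measurable -> measurable C ->
  (forall A B, G A -> H B -> P (A `&` B `&` C) = P (A `&` B) * P C) ->
  forall A, <<s G `|` H >> A -> P (A `&` C) = P A * P C.
Proof.
move=> sG sH mG mH mC GHC A.
pose GH := [set A `&` B | A in G & B in H].
have GT : G setT by case: sG => G0 GC _; rewrite -[setT]setD0; exact: GC.
have HT : H setT by case: sH => H0 HC _; rewrite -[setT]setD0; exact: HC.
have GI : setI_closed G by exact: sigma_algebra_setI.
have HI : setI_closed H by exact: sigma_algebra_setI.
move=> GHA; apply: (@indep_g_sigma_algebra GH) => //.
- by move=> _ [B GB [B' HB' <-]]; apply: measurableI; [exact: mG|exact: mH].
- move=> _ _ [B GB [B' HB' <-]] [D GD [D' HD' <-]].
  by exists (B `&` D); [exact: GI|exists (B' `&` D'); [exact: HI|rewrite setIACA]].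
- by move=> _ [B GB [B' HB' <-]]; exact: GHC.
- move: A GHA; apply: sub_sigma_algebra2 => B [GB|HB].
    by exists B => //; exists setT => //; rewrite setIT.
  by exists setT => //; exists B => //; rewrite setTI.
Qed.

Section family.
Context {d'} {T' : measurableType d'} {I : choiceType} (D : set I).
Context (X : I -> {mfun T >-> T'}).
Hypothesis X_indep : independent P D (fun i => g_sigma_algebra_preimage (X i)).

Lemma sigma_family_measurable (D' : set I) :
  sigma_family D' (fun i => X i : T -> T') `<=` measurable.
Proof.
apply: smallest_sub; first exact: sigma_algebra_measurable.
by move=> A [i _ [B mB <-]]; exact: measurable_funP.
Qed.

(** This is what allows one [X i] to be integrated out while [G] and all the other [X j] are
    frozen. *)
Lemma indep_member_sigma_join (G : set (set T)) :
  sigma_algebra [set: T] G -> G `<=` measurable ->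
  (forall A B, G A -> sigma_family D (fun i => X i : T -> T') B ->
     P (A `&` B) = P A * P B) ->
  forall i B, D i -> measurable B ->
  forall A, <<s G `|` \bigcup_(j in D `\ i) g_sigma_algebra_preimage (X j) >> A ->
    P (A `&` X i @^-1` B) = P A * P (X i @^-1` B).
Proof.
move=> sG mG GX i B Di mB A HA.
have GT : G setT by case: sG => G0 GC _; rewrite -[setT]setD0; exact: GC.
have GI := sigma_algebra_setI _ sG.
(* A pi-system: [A `&` C] with [A] in [G] and [C] a cylinder over the [X j],
   [j != i]. The components of [C] are total in [j], so that the intersection of
   two cylinders is computed componentwise. *)
pose cyl := [set C | exists (J : {fset I}) (F : I -> set T),
  [/\ [set` J] `<=` D `\ i, (forall j, g_sigma_algebra_preimage (X j) (F j)),
      (forall j, j \notin J -> F j = setT) & C = \bigcap_j F j] ].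
have presT j : g_sigma_algebra_preimage (X j) setT.
  by exists setT => //; rewrite setTI preimage_setT.
have cylJ (J : {fset I}) (F : I -> set T) :
    (forall j, j \notin J -> F j = setT) ->
    \bigcap_j F j = \bigcap_(j in [set` J]) F j.
  move=> FT; apply/seteqP; split=> w Fw j; first by move=> _; exact: Fw.
  by move=> _; case: (boolP (j \in J)) => [/Fw//|/FT ->].
pose GX' := [set A1 `&` C | A1 in G & C in cyl].
have cyl_fam C : cyl C -> sigma_family D (fun i => X i : T -> T') C.
  move=> [J [F [JD mF FT ->]]]; rewrite (cylJ J)//.
  apply: (@fin_bigcap_measurable _ (g_sigma_algebraType _)) => // j jJ.
  by apply: sub_sigma_algebra; exists j; [exact: (JD _ jJ).1|exact: mF].
have Xi_fam : sigma_family D (fun i => X i : T -> T') (X i @^-1` B).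
  by apply: sub_sigma_algebra; exists i => //; exists B => //; rewrite setTI.
have cyl_indep C : cyl C -> P (C `&` X i @^-1` B) = P C * P (X i @^-1` B).
  move=> [J [F [JD mF FT ->]]]; rewrite (cylJ J)//.
  have iJ : i \notin J by apply/negP => /JD[_]; exact.
  (* The event on [X i] becomes one more coordinate of the cylinder, available because [i] is not in
     [J]. *)
  pose F' j := if j == i then X i @^-1` B else F j.
  have F'J j : j \in J -> F' j = F j.
    by rewrite /F'; case: eqP => // -> ; rewrite (negbTE iJ).
  have -> : \bigcap_(j in [set` J]) F j `&` X i @^-1` B
            = \bigcap_(j in [set` (i |` J)%fset]) F' j.
    apply/seteqP; split=> w.
      move=> [Fw Xw] j /=; rewrite in_fset1U => /predU1P[->|jJ].
        by rewrite /F' eqxx.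
      by rewrite F'J//; exact: Fw.
    move=> Fw; split; last by have := Fw i; rewrite /= fset1U1 /F' eqxx; exact.
    by move=> j jJ; rewrite -F'J//; apply: Fw => /=; exact: fset1Ur.
  rewrite (X_indep (i |` J)%fset)//; last 2 first.
  - by move=> j /=; rewrite in_fset1U => /predU1P[->//|/JD[]].
  - move=> j _; rewrite /F'; case: eqP => [->|_]; last exact: mF.
    by exists B => //; rewrite setTI.
  rewrite big_fsetU1//= {1}/F' eqxx muleC; congr (_ * _).
  rewrite (X_indep J)//; last by move=> j /JD[].
  by apply: eq_big_seq => j jJ; rewrite F'J.
move: A HA.
suff sub : <<s G `|` \bigcup_(j in D `\ i) g_sigma_algebra_preimage (X j) >> `<=`
    <<s GX' >>.
  move=> A /sub; apply: indep_g_sigma_algebra.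
  - move=> _ [A1 GA1 [C cC <-]]; apply: measurableI; first exact: mG.
    exact: (sigma_family_measurable D _ (cyl_fam _ cC)).
  - move=> ? ? [A1 GA1 [_ [J [F [JD mF FT ->]]] <-]].
    move=> [A2 GA2 [_ [J' [F' [JD' mF' FT' ->]]] <-]].
    exists (A1 `&` A2); first exact: GI.
    exists (\bigcap_j (F j `&` F' j)); last by rewrite setIACA -bigcapI.
    exists (J `|` J')%fset, (fun j => F j `&` F' j); split => //.
    + by move=> j /=; rewrite in_fsetU => /orP[/JD|/JD'].
    + move=> j; have := mF' j; have := mF j => -[B1 mB1 <-] [B2 mB2 <-].
      by exists (B1 `&` B2); [exact: measurableI|rewrite !setTI].
    + by move=> j; rewrite in_fsetU negb_or => /andP[/FT -> /FT' ->]; rewrite setTI.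
  - by rewrite -[X in measurable X]setTI; exact: measurable_funP.
  (* Split off [A1] from [C] and the event on [X i], both in the family; split these two by
     [cyl_indep]; then merge [A1] with [C] again. *)
  - move=> _ [A1 GA1 [C cC <-]]; rewrite -setIA GX//; last first.
      by apply: (@measurableI _ (g_sigma_algebraType _)); [exact: cyl_fam|].
    by rewrite cyl_indep// muleA GX//; exact: cyl_fam.
(* Generators lie in [GX']: a set of [G] is paired with the cylinder without constraints, a set
   coming from [X j] with the whole space. *)
apply: sub_sigma_algebra2 => A [GA|[j [Dj ji] preA]].
  exists A => //; exists setT; last by rewrite setIT.
  exists fset0, (fun=> setT); split => //.
  by rewrite bigcapT.
exists setT => //; exists A; last by rewrite setTI.
exists [fset j]%fset, (fun k => if k == j then A else setT); split => //.
- by move=> k /=; rewrite in_fset1 => /eqP ->; split => // /esym.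
- by move=> k; case: eqP => [->|].
- by move=> k; rewrite in_fset1 => /negbTE ->.
- apply/seteqP; split => w; first by move=> Aw k _; case: eqP.
  by move=> /(_ j Logic.I); rewrite eqxx.
Qed.

End family.
End independence.

(** * Integrating out finitely many exponential variables *)

Section exponential_thresholds.
Context {R : realType} {d} {T : measurableType d} {P : probability T R}.
Context {I : choiceType} (D : set I) (E : I -> {mfun T >-> R}).
Local Open Scope ereal_scope.
Hypothesis E_indep : independent P D (fun i => g_sigma_algebra_preimage (E i)).
Hypothesis E_law : forall i, D i -> forall B, measurable B ->
  distribution P (E i) B = exponential_prob 1 B.
Context (G : set (set T)).
Hypothesis sG : sigma_algebra [set: T] G.
Hypothesis mG : G `<=` measurable.
Hypothesis G_indep : forall A B, G A ->
  sigma_family D (fun i => E i : T -> R) B -> P (A `&` B) = P A * P B.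
Let TG := g_sigma_algebraType G.
Context (W : I -> T -> \bar R).
Hypothesis mW : forall i, measurable_fun [set: TG] (W i : TG -> \bar R).
Hypothesis W0 : forall i w, 0 <= W i w.

(** Induction on [L] for all [f] at once: integrating out [E i] leaves the factor [expeR (- W i w)],
    which is measurable for [G] and is absorbed into [f]. *)
Lemma ge0_integral_exponential_thresholds (L : seq I) (f : T -> \bar R) :
  uniq L -> (forall i, i \in L -> D i) ->
  measurable_fun [set: TG] (f : TG -> \bar R) -> (forall w, 0 <= f w) ->
  \int[P]_w (f w * (\prod_(i <- L) \1_[set w | (W i w <= (E i w)%:E)%E] w)%R%:E) =
  \int[P]_w (f w * expeR (- \sum_(i <- L) W i w)).
Proof.
elim: L f => [|i L IH] f.
  by move=> *; apply: eq_integral => w _; rewrite !big_nil oppe0 expeR0.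
move=> /= /andP[iL uL] DL mf f0.
have Di : D i by apply: DL; rewrite mem_head.
have DL' j : j \in L -> (D `\ i) j.
  move=> jL; split; first by apply: DL; rewrite inE jL orbT.
  by move=> /= ji; rewrite -ji jL in iL.
pose H := G `|` \bigcup_(j in D `\ i) g_sigma_algebra_preimage (E j).
pose TH := g_sigma_algebraType H.
have GH A : <<s G >> A -> <<s H >> A by apply: sub_sigma_algebra2 => B GB; left.
have sGH (g : T -> \bar R) : measurable_fun [set: TG] (g : TG -> \bar R) ->
    measurable_fun [set: TH] (g : TH -> \bar R).
  by move=> mg _ B mB; apply: GH; exact: mg.
have mH : <<s H >> `<=` measurable.
  apply: smallest_sub; first exact: sigma_algebra_measurable.
  by move=> A [/mG//|[j _ [B mB <-]]]; exact: measurable_funP.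
(* The identity onto [T] with the coarser sigma-algebra generated by [H] serves as the variable [h]
   of the one-threshold lemma. *)
have mid : measurable_fun [set: T] (id : T -> TH).
  by move=> _ B mB; rewrite setTI; exact: mH.
have indep A B : @measurable _ TH A -> measurable B ->
    P (id @^-1` A `&` E i @^-1` B) = P (id @^-1` A) * P (E i @^-1` B).
  move=> mA mB.
  exact: (indep_member_sigma_join D E E_indep G sG mG G_indep i B Di mB A mA).
pose ind j w : R := \1_[set w | (W j w <= (E j w)%:E)%E] w.
have mind j : j \in L -> measurable_fun [set: TH] (ind j : TH -> R).
  move=> jL; apply: measurable_indic.
  rewrite -[X in measurable X]setTI; apply: measurable_lee => //; first exact: sGH.
  apply/measurable_EFinP => _ B mB; apply: sub_sigma_algebra.
  by right; exists j; [exact: DL'|exists B].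
have mrest : measurable_fun [set: TH] (fun w : TH => f w * (\prod_(j <- L) ind j w)%R%:E).
  apply: emeasurable_funM; first exact: sGH.
  exact/measurable_EFinP/measurable_prod.
have rest0 w : 0 <= f w * (\prod_(j <- L) ind j w)%R%:E.
  by rewrite mule_ge0// lee_fin prodr_ge0.
transitivity (\int[P]_w ((f w * (\prod_(j <- L) ind j w)%R%:E) * (ind i w)%:E)).
  by apply: eq_integral => w _; rewrite big_cons EFinM [X in _ * X]muleC muleA.
have := @ge0_integral_exponential_threshold R d _ T TH P
  (mfun_Sub (mem_set mid)) (E i) (E_law i Di) indep
  (fun w => f w * (\prod_(j <- L) ind j w)%R%:E) (W i) mrest (sGH _ (mW i)) rest0 (W0 i).
rewrite /=.
move=> ->.
(* [E i] is gone; the induction hypothesis applies with the new factor [f w * expeR (- W i w)]. *)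
transitivity (\int[P]_w ((f w * expeR (- W i w)) * (\prod_(j <- L) ind j w)%R%:E)).
  by apply: eq_integral => w _; rewrite muleAC.
rewrite IH//.
- apply: eq_integral => w _; rewrite big_cons -muleA -expeRD oppeD//.
  by rewrite ge0_adde_def// inE// sume_ge0.
- by move=> j jL; case: (DL' j jL).
- apply: emeasurable_funM => //.
  by apply: measurableT_comp; [exact: measurable_expeR|exact: measurableT_comp].
- by move=> w; rewrite mule_ge0// expeR_ge0.
Qed.

End exponential_thresholds.

(** * Exhausting a countable set of labels by finite lists *)

Section exhaustion.
Context {I : countType} (p : pred I).

Definition first_labels (k : nat) : seq I :=
  [seq v <- pmap pickle_inv (iota 0 k) | p v].

Lemma first_labels_uniq k : uniq (first_labels k).
Proof. by rewrite filter_uniq// (pmap_uniq pickle_invK)// iota_uniq. Qed.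

Lemma mem_first_labels k v : (v \in first_labels k) = p v && (choice.pickle v < k)%N.
Proof.
rewrite mem_filter; congr (_ && _); rewrite mem_pmap.
apply/mapP/idP => [[i]|vk]; last first.
  by exists (choice.pickle v); rewrite ?mem_iota ?pickleK_inv.
rewrite mem_iota add0n => /andP[_ ik] vi.
by have := @pickle_invK I i; rewrite -vi /= => ->.
Qed.

(** Entries outside [s] contribute the neutral element, so the padded operation is stationary once
    every element of [s] is listed. This serves for sums and for maxima alike. *)
Lemma big_first_labels (U : Type) (idx : U) (op : Monoid.com_law idx) (s : seq I)
    (F : I -> U) : uniq s -> all p s ->
  exists k0, forall k, (k0 <= k)%N ->
    \big[op/idx]_(v <- first_labels k) (if v \in s then F v else idx) =
    \big[op/idx]_(v <- s) F v.
Proof.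
(* One more than the largest code in [s], since [first_labels k] keeps the codes strictly below
   [k]. *)
move=> us /allP ps; exists (\max_(v <- s) choice.pickle v).+1 => k sk.
rewrite -big_mkcond -big_filter; apply: perm_big.
apply: uniq_perm => //; first by rewrite filter_uniq// first_labels_uniq.
move=> v; rewrite mem_filter mem_first_labels; case: (boolP (v \in s)) => //= vs.
by rewrite ps//= (leq_trans _ sk)// ltnS leq_bigmax_seq.
Qed.

Lemma cvg_big_first_labels (U : topologicalType) (idx : U) (op : Monoid.com_law idx)
    (s : seq I) (F : I -> U) : uniq s -> all p s ->
  (fun k => \big[op/idx]_(v <- first_labels k) (if v \in s then F v else idx)) @ \oo
    --> \big[op/idx]_(v <- s) F v.
Proof.
move=> us ps; have [k0 k0P] := big_first_labels _ _ op _ F us ps.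
by apply: cvg_near_cst; exists k0 => // k /= /k0P.
Qed.

End exhaustion.

(** * Generations and positions of the branching random walk *)

Section branching_random_walk_theory.
Context {R : realType} {d} {T : measurableType d} (X : seq nat -> point_process T R).

Lemma mem_generation_rcons n u j w :
  (rcons u j \in generation X n.+1 w) =
  (u \in generation X n w) && (j < pp_size (X u) w)%N.
Proof.
apply/allpairsPdep/andP => [[v [i [vn ij /rcons_inj[-> ->]]]]|[un ju]].
  by rewrite vn; rewrite mem_iota add0n in ij.
by exists u, j; rewrite mem_iota add0n ju.
Qed.

Lemma size_generation n w v : v \in generation X n w -> size v = n.
Proof.
elim: n v => [|n IH] v /=; first by rewrite inE => /eqP ->.
by move=> /allpairsPdep[u [j [/IH un _ ->]]]; rewrite size_rcons un.
Qed.

Lemma all_size_generation n w : all (fun v => size v == n) (generation X n w).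
Proof. by apply/allP => v /size_generation ->. Qed.

Lemma generation_uniq n w : uniq (generation X n w).
Proof.
elim: n => //= n IH; apply: allpairs_uniq_dep => //.
  by move=> u _; exact: iota_uniq.
by move=> [u i] [v j] _ _ /= /rcons_inj[-> ->].
Qed.

Lemma measurable_alive n v : measurable [set w | v \in generation X n w].
Proof.
elim: n v => [|n IH] v.
  rewrite /=; case: (boolP (v \in [:: [::]])) => _.
    by rewrite (_ : [set _ | _] = setT)//; apply/seteqP.
  by rewrite (_ : [set _ | _] = set0)//; apply/seteqP; split.
case/lastP: v => [|u j].
  rewrite (_ : [set _ | _] = set0)// -subset0 => w /=.
  by move=> /allpairsPdep[u [j [_ _ /(congr1 size)]]]; rewrite size_rcons.
rewrite (_ : [set _ | _] = [set w | u \in generation X n w] `&`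
    pp_size (X u) @^-1` [set k | (j < k)%N]).
  apply: measurableI => //.
  by rewrite -[X in measurable X]setTI; exact: measurable_funP.
by apply/seteqP; split => w /=; rewrite mem_generation_rcons => /andP.
Qed.

Lemma measurable_position v : measurable_fun [set: T] (position X v).
Proof. by apply: measurable_sum => i; exact: measurable_funP. Qed.

Lemma brw_sigma_measurable n : brw_sigma X n `<=` measurable.
Proof.
apply: smallest_sub; first exact: sigma_algebra_measurable.
move=> _ [v [B [_ mB ->]]]; apply: measurableI; first exact: measurable_alive.
by rewrite -[X in measurable X]setTI; exact: measurable_position.
Qed.

(** Defined for every label, with value [0] at dead ones, so that a sum over a fixed list of labels
    sees only living particles. *)
Definition brw_weight (h : R -> R) (n : nat) (v : seq nat) (w : T) : R :=
  if v \in generation X n w then h (position X v w) else 0.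

(** [brw_sigma] records positions of living particles only. The weight is constant on the event that
    [v] is dead, so its preimages use nothing more. *)
Lemma brw_sigma_weight_preimage (h : R -> R) n v (B : set R) : measurable_fun setT h ->
  size v = n -> measurable B -> brw_sigma X n (brw_weight h n v @^-1` B).
Proof.
move=> mh vn mB.
have mhB : measurable (h @^-1` B) by rewrite -[X in measurable X]setTI; exact: mh.
have alive (C : set R) : measurable C ->
    brw_sigma X n [set w | v \in generation X n w /\ C (position X v w)].
  by move=> mC; apply: sub_sigma_algebra; exists v, C; rewrite vn.
(* The event that [v] is dead is the complement of a generator, the one with position in [setT]; it
   belongs to the preimage exactly when [B] contains [0]. *)
rewrite (_ : _ @^-1` _ =
   [set w | v \in generation X n w /\ (h @^-1` B) (position X v w)] `|`
   (if 0 \in B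
    then ~` [set w | v \in generation X n w /\ setT (position X v w)]
    else set0)).
  apply: (@measurableU _ (g_sigma_algebraType _)); first exact: alive.
  case: ifP => _; last exact: (@measurable0 _ (g_sigma_algebraType _)).
  by apply: (@measurableC _ (g_sigma_algebraType _)); exact: alive.
apply/seteqP; split => w /=; rewrite /brw_weight.
  case: ifPn => [vw Bw|vw B0]; first by left.
  by right; rewrite mem_set//= => -[] //; rewrite (negbTE vw).
move=> [[-> //]|]; case: ifPn => // /set_mem B0 /= nv.
by case: ifPn => // vw; case: nv.
Qed.

End branching_random_walk_theory.

(** * From logarithmic inequalities to thresholds *)

Section ereal_thresholds.
Context {R : realType}.
Implicit Types (y z : \bar R) (a e x theta : R).
Local Open Scope ereal_scope.

(** Positivity of [e] makes [lne e%:E] finite, so it can be moved to the right even when [lne y] is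
    infinite; then exponentiate. *)
Lemma lne_sub_le y e x : 0 <= y -> (0 < e)%R ->
  (lne y - lne e%:E <= x%:E) = ((expR (- x))%:E * y <= e%:E).
Proof.
move=> y0 e0; rewrite lne_EFin//.
rewrite leeBlDr// -EFinD lne_le_EFin expRD lnK ?posrE// expRN.
rewrite EFinM [in RHS]muleC.
have x0 := expR_gt0 x.
by rewrite lee_pdivrMr// muleC.
Qed.

Lemma adde_mule_le_EFin a theta z x : (0 < theta)%R ->
  (a%:E + theta^-1%:E * z <= x%:E) = (z <= (theta * (x - a))%:E).
Proof.
move=> t0; have ti0 : (0 < theta^-1)%R by rewrite invr_gt0.
case: z => [r| |].
- by rewrite -EFinM -EFinD !lee_fin -lerBrDl mulrC ler_pdivrMr// mulrC.
- by rewrite gt0_muley// addey.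
- by rewrite gt0_muleNy// addeNy// !leNye.
Qed.

Lemma bigmaxe_le (I : eqType) (s : seq I) (F : I -> \bar R) z :
  (\big[maxe/-oo]_(v <- s) F v <= z) <-> (forall v, v \in s -> F v <= z).
Proof.
elim: s => [|u s IH]; first by rewrite big_nil leNye.
rewrite big_cons ge_max; split => [/andP[Fu /IH Fs] v|Fs].
  by rewrite inE => /predU1P[->//|/Fs].
by rewrite Fs ?mem_head//=; apply/IH => v vs; apply: Fs; rewrite inE vs orbT.
Qed.

End ereal_thresholds.

(** * Product formulas for two and three sigma-algebras *)

Section finite_independence.
Context {R : realType} {d} {T : measurableType d} {P : probability T R}.
Implicit Types F : set (set T).
Local Open Scope ereal_scope.

Lemma indep_ord m (F : 'I_m -> set (set T)) (A : 'I_m -> set T) :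
  independent P [set: 'I_m] F -> (forall i, F i (A i)) ->
  P (\bigcap_i A i) = \prod_(i < m) P (A i).
Proof.
move=> indF FA; pose J := [fset i | i in 'I_m]%fset.
have JT i : i \in J by rewrite in_fset.
rewrite (_ : \bigcap_i A i = \bigcap_(i in [set` J]) A i); last first.
  by apply/seteqP; split => w Aw i _; apply: Aw => //=.
rewrite indF//; apply: perm_big; apply: uniq_perm; rewrite ?fset_uniq//.
  exact: index_enum_uniq.
by move=> i; rewrite JT mem_index_enum.
Qed.

Lemma indep3 F1 F2 F3 A B C :
  independent P [set: 'I_3] (tnth [tuple F1; F2; F3]) -> F1 A -> F2 B -> F3 C ->
  P (A `&` B `&` C) = P A * P B * P C.
Proof.
move=> indF A1 B2 C3.
have := indep_ord _ _ (tnth [tuple A; B; C]) indF.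
rewrite !big_ord_recl big_ord0 mule1 !(tnth_nth set0)/= muleA => <-; last first.
  by move=> [[|[|[|]]]] i3 //; rewrite !(tnth_nth set0).
congr (P _); apply/seteqP; split => w.
  by move=> [[Aw Bw] Cw] [[|[|[|]]]] i3 // _; rewrite (tnth_nth set0).
by move=> Aw; split; [split|];
  [have := Aw ord0 Logic.I|have := Aw (inord 1) Logic.I
  |have := Aw (inord 2) Logic.I];
  rewrite (tnth_nth set0) /= ?inordK.
Qed.

Lemma indep2 F1 F2 A B :
  independent P [set: 'I_2] (tnth [tuple F1; F2]) -> F1 A -> F2 B ->
  P (A `&` B) = P A * P B.
Proof.
move=> indF A1 B2; have := indep_ord _ _ (tnth [tuple A; B]) indF.
rewrite !big_ord_recl big_ord0 mule1 !(tnth_nth set0)/= => <-; last first.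
  by move=> [[|[|]]] i2 //; rewrite !(tnth_nth set0).
congr (P _); apply/seteqP; split => w.
  by move=> [Aw Bw] [[|[|]]] i2 // _; rewrite (tnth_nth set0).
by move=> Aw; split; [have := Aw ord0 Logic.I|have := Aw (inord 1) Logic.I];
  rewrite (tnth_nth set0) /= ?inordK.
Qed.

End finite_independence.

(** * Events equal up to null sets, and laws determined by rays *)

Section ae_equality.
Context {R : realType} {d} {T : measurableType d} {P : probability T R}.
Local Open Scope ereal_scope.

Lemma negligible_eq_measure (N A B : set T) : P.-negligible N ->
  measurable A -> measurable B -> (forall w, ~ N w -> (A w <-> B w)) -> P A = P B.
Proof.
move=> N0 mA mB AB.
rewrite -[A]setIT -[B]setIT -!integral_indic//.
apply: ge0_ae_eq_integral => //; try exact/measurable_EFinP/measurable_indic.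
apply: (negligibleS _ N0) => w /= ABw; apply: contrapT => Nw; apply: ABw => _.
rewrite !indicE; suff -> : (w \in A) = (w \in B) by [].
by apply/idP/idP => /set_mem w0; apply/mem_set; apply/AB.
Qed.

(** Rays with real endpoint never contain [+oo]. The whole space is therefore added to the
    pi-system, and equality of total masses is a hypothesis. *)
Lemma eq_measure_ereal_ray (m1 m2 : {finite_measure set (\bar R) -> \bar R}) :
  m1 setT = m2 setT ->
  (forall r : R, m1 [set y | y <= r%:E] = m2 [set y | y <= r%:E]) ->
  forall B, measurable B -> m1 B = m2 B.
Proof.
move=> mT mray B mB.
pose C := [set A : set (\bar R) | A = setT \/ exists r : R, A = [set y | y <= r%:E]].
apply: (g_sigma_algebra_measure_unique C _ (fun=> setT)).
- move=> _ [->//|[r ->]].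
  by rewrite -[X in measurable X]setTI; exact: emeasurable_fun_infty_c.
- by move=> _; left.
- by rewrite -subTset => y _; exists 0%N.
- move=> _ _ [->|[r ->]] [->|[s ->]]; rewrite ?setIT ?setTI;
    [by left|by right; exists s|by right; exists r|].
  right; exists (Num.min r s).
  by apply/seteqP; split => y /=; rewrite EFin_min le_min => /andP.
- by move=> A [->|[r ->]]; [exact: mT|exact: mray].
- by move=> _; rewrite ltey_eq fin_num_measure.
have := mB; rewrite /measurable/= ErealGenOInfty.measurableE.
apply: smallest_sub; first exact: smallest_sigma_algebra.
move=> _ [r ->]; rewrite (_ : [set` _] = ~` [set y | y <= r%:E]).
  by apply: sigma_algebraC; apply: sub_sigma_algebra; right; exists r.
by apply/seteqP; split => y /=; rewrite in_itv/= andbT ltNge => /negP.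
Qed.

End ae_equality.

(** * Measurability of the weighted sum and of the maximum *)

Lemma measurable_expR_mul {R : realType} (theta : R) :
  measurable_fun [set: R] (fun s : R => expR (theta * s)).
Proof. by apply: (measurableT_comp (@measurable_expR R)); exact: measurable_funM. Qed.

Section lpm_measurability.
Context {R : realType} {d} {T : measurableType d} (X : seq nat -> point_process T R).
Context (theta : R) (n : nat).
Context (Y : seq nat -> {mfun T >-> \bar R}) (E : seq nat -> {mfun T >-> R}).
Local Open Scope ereal_scope.

Let label (v : seq nat) := size v == n.

(** The list of summands is random, so the sum is written as a limit of sums over fixed lists, with
    dead labels padded by [0]. The maximum is treated alike, with padding [-oo]. *)
Lemma measurable_lpm_sum : measurable_fun [set: T] (lpm_sum X theta n Y).
Proof.
apply: (emeasurable_fun_cvg (fun k w =>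
    \sum_(v <- first_labels label k) if v \in generation X n w then
      (expR (theta * position X v w))%:E * Y v w else 0)).
  move=> k; apply: emeasurable_sum => v; apply: measurable_fun_ifT => //.
    by apply: (measurable_fun_bool true); rewrite setTI; exact: measurable_alive.
  apply: emeasurable_funM => //; apply/measurable_EFinP.
  exact: (measurableT_comp (measurable_expR_mul theta) (measurable_position X v)).
move=> w _; rewrite /lpm_sum.
exact: (cvg_big_first_labels label _ _ _ _ _
  (generation_uniq _ _ _) (all_size_generation _ _ _)).
Qed.

Lemma measurable_lpm_max : measurable_fun [set: T] (lpm_max X theta n Y E).
Proof.
apply: (emeasurable_fun_cvg (fun k w =>
    \big[maxe/-oo]_(v <- first_labels label k) if v \in generation X n w then
      (position X v w)%:E + theta^-1%:E * (lne (Y v w) - lne (E v w)%:E)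
    else -oo)).
  move=> k; elim: (first_labels label k) => [|v s IH].
    by under eq_fun do rewrite big_nil; exact: measurable_cst.
  under eq_fun do rewrite big_cons; apply: measurable_maxe => //.
  apply: measurable_fun_ifT => //.
    by apply: (measurable_fun_bool true); rewrite setTI; exact: measurable_alive.
  apply: emeasurable_funD; first by apply/measurable_EFinP; exact: measurable_position.
  apply: emeasurable_funM => //; apply: emeasurable_funB.
    by apply: measurableT_comp; first exact: measurable_lne.
  apply: measurableT_comp; first exact: measurable_lne.
  exact/measurable_EFinP.
move=> w _; rewrite /lpm_max.
exact: (cvg_big_first_labels label _ _ _ _ _
  (generation_uniq _ _ _) (all_size_generation _ _ _)).
Qed.

End lpm_measurability.

(** * The last progeny modification *)

Section lpm.
Context {R : realType} {d} {T : measurableType d} {P : probability T R}.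
Context {X : seq nat -> point_process T R} {theta : R} {n : nat}.
Context {mu : probability (\bar R) R}.
Context {Y : seq nat -> {mfun T >-> \bar R}} {E : seq nat -> {mfun T >-> R}}.
Hypothesis theta_gt0 : 0 < theta.
Hypothesis mu_ge0 : mu [set y | (0 <= y)%E] = 1%E.
Hypothesis marks : is_lpm_marks X n Y E P mu.
Local Open Scope ereal_scope.

Let D : set (seq nat) := [set v | size v = n].
Let YS := sigma_family D (fun v => Y v : T -> \bar R).
Let ES := sigma_family D (fun v => E v : T -> R).

Lemma lpm_indep3 A B C : brw_sigma X n A -> YS B -> ES C ->
  P (A `&` B `&` C) = P A * P B * P C.
Proof.
move=> hA hB hC.
exact: (indep3 _ _ _ _ _ _ (lpm_indep marks) hA hB hC).
Qed.

(** The information that conditioning would freeze: the walk and all the marks [Y v]. *)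
Let G := <<s brw_sigma X n `|` YS >>.

Lemma join_sigma_algebra : sigma_algebra [set: T] G.
Proof. exact: smallest_sigma_algebra. Qed.

Lemma join_measurable : G `<=` measurable.
Proof.
apply: smallest_sub; first exact: sigma_algebra_measurable.
move=> A [|]; first exact: brw_sigma_measurable.
exact: sigma_family_measurable.
Qed.

Lemma G_indep A C : G A -> ES C -> P (A `&` C) = P A * P C.
Proof.
move=> GA EC; have brwT : brw_sigma X n setT.
  exact: (@measurableT _ (g_sigma_algebraType _)).
have YST : YS setT by exact: (@measurableT _ (g_sigma_algebraType _)).
have EST : ES setT by exact: (@measurableT _ (g_sigma_algebraType _)).
apply: (indep_sigma_join (brw_sigma X n) YS) GA.
- exact: smallest_sigma_algebra.
- exact: smallest_sigma_algebra.
- exact: brw_sigma_measurable.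
- exact: sigma_family_measurable.
- exact: sigma_family_measurable EC.
- move=> A1 B bA YB; rewrite lpm_indep3//.
  by rewrite -[in RHS](setIT (A1 `&` B)) lpm_indep3// probability_setT mule1.
Qed.

(** The marks have the right signs only almost surely, and the passage from logarithms to thresholds
    needs them. All labels of length [n] are included, living or dead, so that this is a countable
    union of null sets. *)
Let bad := [set w | exists2 v, size v = n & ((E v w <= 0)%R \/ Y v w < 0)].

Lemma bad_negligible : P.-negligible bad.
Proof.
have badv v : size v = n -> P.-negligible [set w | (E v w <= 0)%R \/ Y v w < 0].
  move=> vn; apply: negligibleU.
    by apply: exponential_le0_negligible => B mB; exact: (lpm_E_law marks vn mB).
  have mneg : measurable [set y : \bar R | y < 0].
    by rewrite -[X in measurable X]setTI; exact: emeasurable_fun_infty_o.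
  apply/negligibleP; first exact: (measurable_funPTI (Y v) mneg).
  transitivity (distribution P (Y v) [set y : \bar R | y < 0]) => //.
  rewrite (lpm_Y_law marks)//.
  have -> : [set y : \bar R | y < 0] = ~` [set y | 0 <= y].
    by apply/seteqP; split => y /=; rewrite ltNge => /negP.
  rewrite probability_setC//; last first.
    by rewrite -[X in measurable X]setTI; exact: emeasurable_fun_c_infty.
  by move: mu_ge0 => /= ->; rewrite subee.
(* The union runs over codes; a code of no label, or of a label of another length, contributes the
   empty set. *)
rewrite (_ : bad = \bigcup_k (if pickle_inv k is Some v then
   (if size v == n then [set w | (E v w <= 0)%R \/ Y v w < 0] else set0)
   else set0)).
  apply: negligible_bigcup => k.
  case: (pickle_inv k) => [v|]; last exact: negligible_set0.
  by case: eqP => [/badv//|_]; exact: negligible_set0.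
apply/seteqP; split => w.
  move=> [v vn vw]; exists (choice.pickle v) => //.
  by rewrite pickleK_inv vn eqxx.
move=> [k _]; case: (pickle_inv k) => // v; case: eqP => // vn vw.
by exists v.
Qed.

Let label (v : seq nat) := size v == n.
(** Truncation at [0] makes the thresholds nonnegative at every point, as the integration lemma
    requires; it changes nothing off [bad]. *)
Let posY v : {mfun T >-> \bar R} := mfun_Sub (mem_set
  (measurable_maxe (@measurable_funP _ _ _ _ setT (Y v)) (measurable_cst 0))).
Let weight := brw_weight X (fun s => expR (theta * s)) n.

Lemma brw_weight_dead v w : v \notin generation X n w -> weight v w = 0%R.
Proof. by rewrite /weight /brw_weight => /negbTE ->. Qed.

(** * The probability that all thresholds are met *)

Section threshold.
Variable c : R.
Hypothesis c_gt0 : (0 < c)%R.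

Let W v w : \bar R := (c * weight v w)%:E * posY v w.

Lemma threshold_ge0 v w : 0 <= W v w.
Proof.
rewrite mule_ge0//; last by rewrite le_max lexx orbT.
rewrite lee_fin mulr_ge0 ?(ltW c_gt0)// /weight /brw_weight.
by case: ifP => // _; exact: expR_ge0.
Qed.

Lemma measurable_threshold v :
  measurable_fun [set: g_sigma_algebraType G] (W v : g_sigma_algebraType G -> \bar R).
Proof.
(* A label of another length is never in generation [n], so its threshold vanishes identically. *)
case: (eqVneq (size v) n) => vn; last first.
  rewrite (_ : W v = cst 0); first exact: measurable_cst.
  apply/funext => w; rewrite /W brw_weight_dead ?mulr0 ?mul0e//.
  by apply/negP => /size_generation; exact/eqP.
apply: emeasurable_funM.
  apply/measurable_EFinP; apply: measurable_funM => // _ B mB; rewrite setTI.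
  (* Two layers: [G] is itself a generated sigma-algebra, and [g_sigma_algebraType G] generates once
     more from it. *)
  do 2 apply: sub_sigma_algebra; left.
  by apply: brw_sigma_weight_preimage => //; exact: measurable_expR_mul.
apply: measurable_maxe => // _ B mB.
do 2 apply: sub_sigma_algebra; right.
by apply: sub_sigma_algebra; exists v => //; exists B.
Qed.

(* For a dead label [v] the condition is [0 <= E v w], which may fail on a null
   set; this is why [A] matches [lpm_max] only outside [bad]. *)
Let A k := [set w | forall v, v \in first_labels label k -> W v w <= (E v w)%:E].

Let measurable_thresholdT v : measurable_fun [set: T] (W v).
Proof.
move=> _ B mB; have := measurable_threshold v measurableT B mB.
apply: smallest_sub; first exact: sigma_algebra_measurable.
exact: join_measurable.
Qed.

Lemma measurable_first_thresholds k : measurable (A k).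
Proof.
rewrite (_ : A k = \bigcap_(v in [set` first_labels label k])
    [set w | W v w <= (E v w)%:E]).
  apply: fin_bigcap_measurable => // v _.
  rewrite -[X in measurable X]setTI; apply: measurable_lee => //.
  exact/measurable_EFinP.
by apply/seteqP; split => w Aw v /= vk; exact: Aw.
Qed.

Let mA := measurable_first_thresholds.

Lemma prob_first_thresholds k :
  P (A k) = \int[P]_w expeR (- \sum_(v <- first_labels label k) W v w).
Proof.
have := @ge0_integral_exponential_thresholds R d T P _ D E (lpm_E_indep marks)
  (fun v vn B mB => lpm_E_law marks vn mB) G join_sigma_algebra join_measurable
  G_indep W measurable_threshold threshold_ge0 (first_labels label k) (cst 1).
move=> thr; rewrite -[A k]setIT -integral_indic//.
transitivity (\int[P]_w
    (cst 1 w * expeR (- \sum_(v <- first_labels label k) W v w)));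
  last by apply: eq_integral => w _; rewrite mul1e.
rewrite -thr//.
- apply: eq_integral => w _; rewrite mul1e; congr (_%:E).
  rewrite indicE; case: (boolP (w \in A k)) => [/set_mem Aw|].
    rewrite big_seq big1// => v vk; rewrite indicE mem_set//; exact: Aw.
  rewrite notin_setE => /existsNP[v /not_implyP[vk Wv]].
  apply/esym/eqP; rewrite prodf_seq_eq0; apply/hasP; exists v => //=.
  by rewrite indicE memNset.
- exact: first_labels_uniq.
- by move=> v; rewrite mem_first_labels => /andP[/eqP].
Qed.

(** Let [k] tend to infinity in [prob_first_thresholds]. The events [A k] decrease, so the left side
    converges by continuity from above. On the right the integrand is eventually constant in [k] at
    each point and bounded by [1], so dominated convergence applies. *)
Lemma prob_thresholds : P (\bigcap_k A k) =
  \int[P]_w expeR (- (c%:E * lpm_sum X theta n posY w)).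
Proof.
have Acvg : P (A k) @[k --> \oo] --> P (\bigcap_k A k).
  apply: nonincreasing_cvg_mu => //.
  - by rewrite ltey_eq fin_num_measure.
  - exact: bigcapT_measurable.
  - move=> k l kl; apply/subsetPset => w Aw v.
    rewrite mem_first_labels => /andP[lv vk].
    by apply: Aw; rewrite mem_first_labels lv (leq_trans vk).
have Icvg : \int[P]_w expeR (- \sum_(v <- first_labels label k) W v w) @[k --> \oo] -->
  \int[P]_w expeR (- (c%:E * lpm_sum X theta n posY w)).
  have cv w : (fun k => expeR (- \sum_(v <- first_labels label k) W v w)) @ \oo -->
     expeR (- (c%:E * lpm_sum X theta n posY w)).
    have [k0 k0P] := big_first_labels label _ _ +%E _
      (fun v => (c * expR (theta * position X v w))%:E * posY v w)
      (generation_uniq X n w) (all_size_generation X n w).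
    have -> : c%:E * lpm_sum X theta n posY w =
        \sum_(v <- generation X n w)
          (c * expR (theta * position X v w))%:E * posY v w.
      rewrite ge0_sume_distrr => [|v _].
        by apply: eq_bigr => v _; rewrite muleA EFinM.
      by rewrite mule_ge0 ?lee_fin ?expR_ge0//= le_max lexx orbT.
    apply: cvg_near_cst; exists k0 => // k /= /k0P <-.
    congr (expeR (- _)); apply: eq_bigr => v _.
    by rewrite /W /weight /brw_weight; case: ifP => //; rewrite mulr0 mul0e.
  have mk k : measurable_fun [set: T]
      (fun w => expeR (- \sum_(v <- first_labels label k) W v w)).
    apply: measurableT_comp; first exact: measurable_expeR.
    by apply: measurableT_comp => //; exact: emeasurable_sum.
  have [|_ _ //] := dominated_convergence measurableT mk
      (emeasurable_fun_cvg _ _ mk (fun w _ => cv w)) (aeW P (fun w _ => cv w))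
      (finite_measure_integrable_cst P 1%R measurableT).
  apply: aeW => w k _; rewrite gee0_abs ?expeR_ge0//= -expeR0 lee_expeR.
  by rewrite leeNl oppe0 sume_ge0// => v _; exact: threshold_ge0.
have PA : (fun k => P (A k)) =
    (fun k => \int[P]_w expeR (- \sum_(v <- first_labels label k) W v w)).
  by apply/funext => k; exact: prob_first_thresholds.
by rewrite -PA in Icvg; exact: (cvg_unique _ Acvg Icvg).
Qed.

End threshold.

Lemma marks_notin_bad w : ~ bad w -> forall v, v \in generation X n w ->
  (0 < E v w)%R /\ 0 <= Y v w.
Proof.
move=> nb v /size_generation vn; split.
  by rewrite ltNge; apply/negP => Ev; apply: nb; exists v => //; left.
by rewrite leNgt; apply/negP => Yv; apply: nb; exists v => //; right.
Qed.

Lemma lpm_sum_ge0 w : ~ bad w -> 0 <= lpm_sum X theta n Y w.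
Proof.
move=> nb; rewrite /lpm_sum big_seq; apply: sume_ge0 => v vw.
by rewrite mule_ge0 ?lee_fin ?expR_ge0//; case: (marks_notin_bad _ nb v vw).
Qed.

(** Off [bad], [Y] coincides with [posY] on generation [n] and the event is the intersection of the
    [A k]; [prob_thresholds] then gives the value. *)
Lemma prob_lpm_max_le (x : R) :
  P [set w | lpm_max X theta n Y E w <= x%:E] =
  \int[P]_w expeR (- ((expR (- (theta * x)))%:E * lpm_sum X theta n Y w)).
Proof.
set c := expR (- (theta * x)); have c0 : (0 < c)%R := expR_gt0 _.
have msum (Y' : seq nat -> {mfun T >-> \bar R}) :
    measurable_fun [set: T] (fun w => expeR (- (c%:E * lpm_sum X theta n Y' w))).
  apply: measurableT_comp; first exact: measurable_expeR.
  apply: measurableT_comp => //.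
  by apply: emeasurable_funM => //; exact: measurable_lpm_sum.
have posYE w v : ~ bad w -> v \in generation X n w -> posY v w = Y v w.
  by move=> nb /(marks_notin_bad _ nb)[_ Yv]; exact/max_idPl.
transitivity (\int[P]_w expeR (- (c%:E * lpm_sum X theta n posY w))); last first.
  apply: ge0_ae_eq_integral => //.
  - by move=> w _; exact: expeR_ge0.
  - by move=> w _; exact: expeR_ge0.
  - apply: (negligibleS _ bad_negligible) => w /= nw; apply: contrapT => nb.
    apply: nw => _; congr (expeR (- (_ * _))).
    by apply: eq_big_seq => v vw; rewrite posYE.
rewrite -(prob_thresholds _ c0).
have mthr (k : nat) : measurable [set w | forall v, v \in first_labels label k ->
    (c * weight v w)%:E * posY v w <= (E v w)%:E].
  exact: measurable_first_thresholds.
have thrE w v : ~ bad w -> v \in generation X n w ->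
    ((position X v w)%:E + theta^-1%:E * (lne (Y v w) - lne (E v w)%:E) <= x%:E) =
    ((c * weight v w)%:E * posY v w <= (E v w)%:E).
  move=> nb vw; have [Ev Yv] := marks_notin_bad _ nb _ vw.
  (* The constants match because [- (theta * (x - S)) = - (theta * x) + theta * S] with [S] the
     position of [v]. *)
  rewrite adde_mule_le_EFin// lne_sub_le// posYE// /weight /brw_weight vw -expRD.
  by rewrite mulrBr opprB addrC.
apply: (negligible_eq_measure _ _ _ bad_negligible).
- rewrite -[X in measurable X]setTI; apply: emeasurable_fun_infty_c => //.
  exact: measurable_lpm_max.
- exact: bigcapT_measurable.
move=> w nb /=; rewrite /lpm_max bigmaxe_le; split => thr.
  move=> k _ v; rewrite mem_first_labels => /andP[/eqP vn _].
  (* A dead label has threshold [0], which [E v] exceeds off [bad]. *)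
  case: (boolP (v \in generation X n w)) => vw; last first.
    rewrite brw_weight_dead// mulr0 mul0e lee_fin leNgt; apply/negP => Ev.
    by apply: nb; exists v => //; left; exact: ltW.
  by rewrite -thrE//; exact: thr.
(* A label appears in [first_labels] as soon as [k] exceeds its code. *)
move=> v vw; rewrite thrE//; apply: (thr (choice.pickle v).+1) => //.
by rewrite mem_first_labels /label (size_generation _ _ _ _ vw) eqxx ltnSn.
Qed.

(** * Comparison with a single exponential variable *)

Section fresh_exponential.
Variable E0 : {mfun T >-> R}.
Hypothesis E0_law : forall B, measurable B ->
  distribution P E0 B = exponential_prob 1 B.
Hypothesis E0_indep : independent P [set: 'I_2]
  (tnth [tuple g_sigma_algebra_preimage (lpm_sum X theta n Y);
               g_sigma_algebra_preimage (E0 : T -> R)]).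

Let S : {mfun T >-> \bar R} := mfun_Sub (mem_set (measurable_lpm_sum X theta n Y)).

Lemma measurable_lne_lpm_sum_sub :
  measurable_fun [set: T] (fun w => lne (lpm_sum X theta n Y w) - lne (E0 w)%:E).
Proof.
apply: emeasurable_funB; apply: measurableT_comp; try exact: measurable_lne.
  exact: measurable_lpm_sum.
exact/measurable_EFinP.
Qed.

(** The one-threshold lemma with [h] the sum [lpm_sum] and [f] equal to [1]; the integral obtained
    is the one for [lpm_max] at [theta * x = r]. *)
Lemma prob_lne_lpm_sum_le (r : R) :
  P [set w | lne (lpm_sum X theta n Y w) - lne (E0 w)%:E <= r%:E] =
  \int[P]_w expeR (- ((expR (- r))%:E * lpm_sum X theta n Y w)).
Proof.
pose c := expR (- r); have c0 : (0 <= c)%R := expR_ge0 _.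
(* Truncated at [0] because [lpm_sum] is nonnegative only off [bad]. *)
pose W (s : \bar R) := c%:E * maxe s 0.
have mW : measurable_fun [set: \bar R] W.
  by apply: emeasurable_funM => //; exact: measurable_maxe.
have W0 s : 0 <= W s by rewrite mule_ge0// le_max lexx orbT.
have indep A B : measurable A -> measurable B ->
    P (S @^-1` A `&` E0 @^-1` B) = P (S @^-1` A) * P (E0 @^-1` B).
  move=> mA mB; apply: (indep2 _ _ _ _ E0_indep).
    by exists A => //; rewrite setTI.
  by exists B => //; rewrite setTI.
pose A := [set w | W (S w) <= (E0 w)%:E].
have mA : measurable A.
  rewrite -[A]setTI; apply: measurable_lee => //; first exact: measurableT_comp.
  exact/measurable_EFinP.
transitivity (P A).
  have N0 := negligibleU bad_negligible (exponential_le0_negligible _ E0_law).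
  apply: (negligible_eq_measure _ _ _ N0) => //.
    rewrite -[X in measurable X]setTI; apply: emeasurable_fun_infty_c => //.
    exact: measurable_lne_lpm_sum_sub.
  move=> w /not_orP[nb /negP]; rewrite -ltNge => Ew /=.
  rewrite lne_sub_le//; last exact: lpm_sum_ge0.
  by rewrite /A/= /W/= (max_idPl (lpm_sum_ge0 _ nb)).
transitivity (\int[P]_w expeR (- W (S w))).
  have := ge0_integral_exponential_threshold S E0 E0_law indep (cst 1) W
    (measurable_cst _) mW (fun _ => lee01) W0.
  under eq_integral do rewrite mul1e.
  under [in RHS]eq_integral do rewrite mul1e.
  by rewrite integral_indic// setIT.
apply: ge0_ae_eq_integral => //.
- apply: measurableT_comp; first exact: measurable_expeR.
  by apply: measurableT_comp => //; exact: measurableT_comp.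
- apply: measurableT_comp; first exact: measurable_expeR.
  apply: measurableT_comp => //.
  by apply: emeasurable_funM => //; exact: measurable_lpm_sum.
- by move=> w _; exact: expeR_ge0.
- by move=> w _; exact: expeR_ge0.
- apply: (negligibleS _ bad_negligible) => w /= nw; apply: contrapT => nb.
  by apply: nw => _; rewrite /W/= (max_idPl (lpm_sum_ge0 _ nb)).
Qed.

(** Both variables have total mass [1] and the same distribution function at real points, and these
    data determine a law on [\bar R]. *)
Lemma lpm_max_law B : measurable B ->
  P [set w | B (theta%:E * lpm_max X theta n Y E w)] =
  P [set w | B (lne (lpm_sum X theta n Y w) - lne (E0 w)%:E)].
Proof.
have mmax : measurable_fun [set: T] (fun w => theta%:E * lpm_max X theta n Y E w).
  by apply: emeasurable_funM => //; exact: measurable_lpm_max.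
apply: (eq_measure_ereal_ray
  (distribution P (mfun_Sub (mem_set mmax)))
  (distribution P (mfun_Sub (mem_set measurable_lne_lpm_sum_sub)))).
  by transitivity (1 : \bar R); [|apply: esym]; exact: probability_setT.
move=> r; rewrite /distribution /pushforward /=.
transitivity (P [set w | lpm_max X theta n Y E w <= (theta^-1 * r)%:E]).
  congr (P _); apply/funext => w; apply/propeqP => /=.
  (* Used with shift [0] and scale [theta^-1], whose inverse is the factor [theta] in front of the
     maximum. *)
  have := adde_mule_le_EFin 0 (theta^-1) (lpm_max X theta n Y E w) r.
  by rewrite add0e invrK subr0 invr_gt0 => ->.
rewrite prob_lpm_max_le mulVKf ?gt_eqF//.
by rewrite -prob_lne_lpm_sum_le.
Qed.

End fresh_exponential.

End lpm.

Theorem corollary3p6 (R : realType)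
    (* the reproduction law *)
    (d0 : measure_display) (T0 : measurableType d0) (P0 : probability T0 R)
    (Z : point_process T0 R)
    (hA1 : assumptionA1 P0 Z) (hA2 : assumptionA2 P0 Z)
    (hA3 : assumptionA3 P0 Z)
    (* the branching random walk *)
    (d : measure_display) (T : measurableType d) (P : probability T R)
    (X : seq nat -> point_process T R) (hX : is_brw X P P0 Z)
    (* the last progeny modification at generation n *)
    (theta : R) (htheta : 0 < theta)
    (mu : probability (\bar R) R) (hmu : mu [set y | (0 <= y)%E] = 1%E)
    (n : nat) (hn : (1 <= n)%N)
    (Y : seq nat -> {mfun T >-> \bar R}) (E : seq nat -> {mfun T >-> R})
    (hYE : is_lpm_marks X n Y E P mu) :
  (forall E0 : {mfun T >-> R},
     (forall B, measurable B -> distribution P E0 B = exponential_prob 1 B) ->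
     independent P [set: 'I_2]
       (tnth [tuple g_sigma_algebra_preimage (lpm_sum X theta n Y);
                    g_sigma_algebra_preimage (E0 : T -> R)]) ->
     forall B : set (\bar R), measurable B ->
       P [set w | B (theta%:E * lpm_max X theta n Y E w)%E] =
       P [set w | B (lne (lpm_sum X theta n Y w) - lne (E0 w)%:E)%E])
  /\
  (forall x : R,
     P [set w | (lpm_max X theta n Y E w <= x%:E)%E] =
     (\int[P]_w
        expeR (- ((expR (- (theta * x)))%:E * lpm_sum X theta n Y w)))%E).
Proof.
split=> [E0 E0_law E0_indep B mB|x].
  exact: (lpm_max_law htheta hmu hYE E0 E0_law E0_indep B mB).
exact: (prob_lpm_max_le htheta hmu hYE x).
Qed.
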